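(* Let $p$ be a prime, $a\ge 1$, $R=\mathbb{Z}/p^a\mathbb{Z}$, and let $\xi$ be a probability distribution on $R$ that is not concentrated on an affine translate of a proper subring of $R$. For every $\epsilon>0$ there is a constant $C(\xi,a,\epsilon)$, depending only on $p,a,\xi,\epsilon$ (and not on $N$, $k$ or $f$), such that for all $N\ge1$ and $k\ge 1$ the following holds. Let $\mathcal{M}_1,\dots,\mathcal{M}_k$ be independent random $N\times N$ matrices over $R$ whose entries are independent with distribution $\xi$, and let $\mathcal{U}_1,\dots,\mathcal{U}_k$ be independent, uniformly random $N\times N$ matrices over $R$. Let $f$ be any function (with values in any set) on $N\times N$ matrices over $R$ that is invariant under the right action of $SL_N(\mathbb{Z}/p^a\mathbb{Z})$, i.e. $f(Ag)=f(A)$ for all $A\in\mathrm{Mat}_{N,N}(R)$ and $g\in SL_N(R)$. Then the total variation distance between the joint distribution of $$\big[f(\mathcal{M}_1),\ f(\mathcal{M}_1\mathcal{M}_2),\ f(\mathcal{M}_1\mathcal{M}_2\mathcal{M}_3),\ \dots,\ f(\mathcal{M}_1\mathcal{M}_2\mathcal{M}_3\cdots\mathcal{M}_k)\big]$$ and the joint distribution of $$\big[f(\mathcal{U}_1),\ f(\mathcal{U}_1\mathcal{U}_2),\ f(\mathcal{U}_1\mathcal{U}_2\mathcal{U}_3),\ \dots,\ f(\mathcal{U}_1\mathcal{U}_2\mathcal{U}_3\cdots\mathcal{U}_k)\big]$$ is bounded above by $$k\,C(\xi,a,\epsilon)\,e^{\epsilon N}\,\big(\|\xi\bmod p\|_2\big)^N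 .$$
   Context: $\|\xi\bmod p\|_2=\Big(\sum_{x\in\mathbb{Z}/p\mathbb{Z}}\Pr[\xi\equiv x \bmod p]^2\Big)^{1/2}$ is the $l^2$ norm of the distribution of the reduction of $\xi$ modulo $p$. An affine translate of a subring $S\subset R$ is a set of the form $\{us+b : s\in S\}$ with $u,b\in R$; subrings contain $1$. *)

(* Defs.v *)
From mathcomp Require Import all_boot all_order all_algebra.
From mathcomp Require Import boolp classical_sets reals sequences exp.

Set Implicit Arguments.
Unset Strict Implicit.
Unset Printing Implicit Defensive.

Import Order.TTheory GRing.Theory Num.Theory.
Local Open Scope ring_scope.

Definition is_pmf (K : realType) (X : finType) (mu : X -> K) : Prop :=
  (forall x, 0 <= mu x) /\ \sum_x mu x = 1.

Definition iid_mx_pmf (K : realType) (R : finType) (xi : R -> K) (N : nat) :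
  'M[R]_N -> K := fun A => \prod_i \prod_j xi (A i j).

Definition unif_mx_pmf (K : realType) (R : finType) (N : nat) : 'M[R]_N -> K :=
  fun=> #|{: 'M[R]_N}|%:R^-1.

Definition iid_pmf (K : realType) (X : finType) (mu : X -> K) (k : nat) :
  {ffun 'I_k -> X} -> K := fun w => \prod_i mu (w i).

(* [V] need not be finite; the law is defined on all subsets of [V]. *)
Definition law (K : realType) (W : finType) (P : W -> K) (V : Type)
  (Y : W -> V) : set V -> K := fun E => \sum_(w | Y w \in E) P w.

(* The supremum is over a nonempty set, bounded when [mu] and [nu] are laws of
   random variables, so [sup] does not take its default value. *)
Definition tv_dist (K : realType) (V : Type) (mu nu : set V -> K) : K :=
  sup [set `|mu E - nu E| | E in [set: set V]]%classic.

Definition affine_translate (R : finNzRingType) (u b : R) (S : {set R}) :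
  {set R} := [set u * s + b | s in S].

Definition concentrated (K : realType) (X : finType) (mu : X -> K)
  (A : {set X}) : Prop := \sum_(x in A) mu x = 1.

(* [GRing.subring_closed] includes [1 \in S]. *)
Definition no_affine_subring (K : realType) (R : finNzRingType)
  (xi : R -> K) : Prop :=
  forall (S : {set R}) (u b : R), GRing.subring_closed S -> S \proper [set: R] ->
    ~ concentrated xi (affine_translate u b S).

(* For [p] prime and [0 < a], the canonical representative [y] in [0, p ^ a) is
   cast into ['Z_p], which is reduction modulo [p]. *)
Definition l2_norm_mod (K : realType) (p a : nat) (xi : 'Z_(p ^ a) -> K) : K :=
  Num.sqrt (\sum_(x : 'Z_p)
    (\sum_(y : 'Z_(p ^ a) | (nat_of_ord y)%:R == x) xi y) ^+ 2).

Definition SL_right_invariant (R : comNzRingType) (N : nat) (T : Type)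
  (f : 'M[R]_N -> T) : Prop :=
  forall A g : 'M[R]_N, \det g = 1 -> f (A *m g) = f A.

(* The [i]-th component is [f (w 0 *m w 1 *m ... *m w i)], with the factors in
   increasing order of index. *)
Definition product_chain (R : nzRingType) (N : nat) (T : Type)
  (f : 'M[R]_N -> T) (k : nat) (w : {ffun 'I_k -> 'M[R]_N}) :
  {ffun 'I_k -> T} :=
  [ffun i : 'I_k => f (\prod_(j < k | (j <= i)%N) w j)].

(* Main.v *)
(** The matrices are replaced by uniform ones one at a time, from the last to the
first. When [M_j] is replaced, [M_(j+1)] is already uniform and absorbs any
[g] in [SL_N], so the joint law of the chain, as a function [h] of [M_j] alone,
is right [SL_N]-invariant. It remains to compare [E h(M)] with [E h(U)], and
this is done one column at a time. By transvections, [h] as a function of the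
replaced column [y] is invariant under translation by the other columns [w_l], so
its Fourier transform is supported on the [v] orthogonal to all [w_l], and
Plancherel bounds the error by the sum of [prod_i |xihat (v_i)|^2] over those
nonzero [v].

A nonzero [v] of weight at most [d] is orthogonal to a random column with
probability at most [s], the [l^2] norm modulo [p], since one coordinate of the column
is then determined modulo [p] by the others; there are few such [v].
If no such [v] occurs, all nonzero multiples of the [v] that do occur have weight
larger than [d], and Fourier inversion shows that [v] is orthogonal to a random
column with probability at most [|ann v| / q * (1 + q rho^(d+1))], where [rho < 1]
bounds the nontrivial Fourier coefficients and [q = p^a]. Summing over the [v] with
a given annihilator then gives [s^(2N)] up to a constant.

If [s = 1] the bound is trivial; if [s < 1] then [xi] is not concentrated on a
residue class modulo [p], which is what makes [rho < 1]. *)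

Require Import Defs.
From mathcomp Require Import all_boot all_order all_algebra all_field.
From mathcomp Require Import boolp classical_sets reals sequences exp.
From mathcomp Require Import ring.
From mathcomp Require Import complex.

Set Implicit Arguments.
Unset Strict Implicit.
Unset Printing Implicit Defensive.

Import Order.TTheory GRing.Theory Num.Theory.
Local Open Scope ring_scope.

(** * Telescoping and resampling for product measures *)

Lemma prodr_subr_telescope (A : comNzRingType) (n : nat) (a b : 'I_n -> A) :
  \prod_i a i - \prod_i b i =
  \sum_j (a j - b j) * \prod_(i | i != j) (if (i < j)%N then a i else b i).
Proof.
elim: n a b => [|n IHn] a b; first by rewrite !big_ord0 subrr.
rewrite [\prod_i a i]big_ord_recr [\prod_i b i]big_ord_recr big_ord_recr /=.
pose W := widen_ord (leqnSn n).
have Wlt (i : 'I_n) : (W i == ord_max) = false by rewrite -val_eqE /= ltn_eqF.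
have -> : \sum_(j < n) (a (W j) - b (W j)) *
     \prod_(i | i != W j) (if (i < j)%N then a i else b i) =
   (\prod_(i < n) a (W i) - \prod_(i < n) b (W i)) * b ord_max.
  rewrite (IHn (fun i => a (W i)) (fun i => b (W i))) mulr_suml.
  apply: eq_bigr => j _; rewrite -mulrA; congr (_ * _).
  rewrite big_mkcond big_ord_recr /= -big_mkcond /= eq_sym Wlt /=.
  by rewrite ltnNge ltnW ?ltn_ord //; congr (_ * _); apply: eq_bigl => i.
have -> : \prod_(i < n.+1 | i != ord_max) (if (i < n)%N then a i else b i)
  = \prod_(i < n) a (W i).
  rewrite big_mkcond big_ord_recr /= eqxx mulr1 /=.
  by apply: eq_bigr => i _; rewrite Wlt ltn_ord.
by rewrite mulrBl mulrBl (mulrC (a ord_max)) (mulrC (b ord_max)) addrC addrA subrK.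
Qed.

Definition ffun_upd (I : finType) (X : Type) (w : {ffun I -> X}) (j : I) (y : X) :
  {ffun I -> X} := [ffun i => if i == j then y else w i].

Lemma ffun_updE (I : finType) (X : Type) (w : {ffun I -> X}) j y i :
  ffun_upd w j y i = if i == j then y else w i.
Proof. by rewrite ffunE. Qed.

Lemma ffun_updK (I : finType) (X : Type) (w : {ffun I -> X}) j y :
  ffun_upd (ffun_upd w j y) j (w j) = w.
Proof. by apply/ffunP => i; rewrite !ffunE; case: eqP => // ->. Qed.

Lemma prod_ffun_upd (A : comNzRingType) (I : finType) (X : Type)
    (c : I -> X -> A) (w : {ffun I -> X}) j y :
  \prod_i c i (ffun_upd w j y i) = c j y * \prod_(i | i != j) c i (w i).
Proof.
rewrite (bigD1 j) //= ffun_updE eqxx; congr (_ * _).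
by apply: eq_bigr => i /negPf ij; rewrite ffun_updE ij.
Qed.

(** Exchanging [w j] with an independent fresh value [y] is an involution on pairs. After the
    exchange the law [c j] appears only as a free factor, which integrates to 1. *)
Lemma sum_resample (A : comNzRingType) (I X : finType) (j : I)
    (c : I -> X -> A) (phi : X -> A) (F : {ffun I -> X} -> A) :
  \sum_x c j x = 1 ->
  \sum_(w : {ffun I -> X}) phi (w j) * (\prod_(i | i != j) c i (w i)) * F w =
  \sum_(w : {ffun I -> X}) \prod_i c i (w i) * \sum_y phi y * F (ffun_upd w j y).
Proof.
move=> cj1; symmetry.
under eq_bigr do rewrite mulr_sumr.
pose sw (u : {ffun I -> X} * X) := (ffun_upd u.1 j u.2, u.1 j).
have swK : involutive sw.
  by move=> [w y]; rewrite /sw /= ffun_updK ffun_updE eqxx.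
rewrite pair_bigA /= (reindex_inj (inv_inj swK)) /=.
rewrite -(pair_bigA _ (fun w y => (\prod_i c i (ffun_upd w j y i)) *
   (phi (w j) * F (ffun_upd (ffun_upd w j y) j (w j))))) /=.
apply: eq_bigr => w _.
under eq_bigr => y _.
  rewrite prod_ffun_upd ffun_updK -mulrA.
  over.
by rewrite -mulr_suml cj1 mul1r mulrCA mulrA.
Qed.

(* Telescoping over the index at which [Q] is switched to [P]; the [j]-th coordinate
   is then resampled, so that the remaining weights form a probability measure. *)
Lemma sum_hybrid (A : comNzRingType) (X : finType) (n : nat)
    (P Q : 'I_n -> X -> A) (F : {ffun 'I_n -> X} -> A) :
  (forall i, \sum_x P i x = 1) -> (forall i, \sum_x Q i x = 1) ->
  \sum_(w : {ffun 'I_n -> X}) (\prod_i P i (w i) - \prod_i Q i (w i)) * F w =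
  \sum_(j < n) \sum_(w : {ffun 'I_n -> X}) \prod_(i < n) (if (i < j)%N then P i else Q i) (w i)
     * \sum_y (P j y - Q j y) * F (ffun_upd w j y).
Proof.
move=> P1 Q1.
under [LHS]eq_bigr do rewrite prodr_subr_telescope mulr_suml.
rewrite exchange_big /=; apply: eq_bigr => j _.
rewrite -(@sum_resample _ _ _ j (fun i => if (i < j)%N then P i else Q i)
            (fun y => P j y - Q j y)); last by rewrite ltnn.
apply: eq_bigr => w _; congr (_ * _ * _).
by apply: eq_bigr => i _; case: ifP.
Qed.

Lemma sum_prod_ffun1 (A : comNzRingType) (I X : finType) (c : I -> X -> A) :
  (forall i, \sum_x c i x = 1) -> \sum_(w : {ffun I -> X}) \prod_i c i (w i) = 1.
Proof. by move=> c1; rewrite -bigA_distr_bigA big1 //= => i _; rewrite c1. Qed.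

(** * Fourier analysis on [R ^ N] with a faithful additive character *)

Definition ffun_dot (R : nzRingType) (N : nat) (v y : {ffun 'I_N -> R}) : R :=
  \sum_i v i * y i.

Section FiniteFourier.

Variables (C : numClosedFieldType) (R : finComNzRingType) (chi : R -> C).
Hypothesis chi0 : chi 0 = 1.
Hypothesis chiD : {morph chi : x y / x + y >-> x * y}.
Hypothesis norm_chi : forall x, `|chi x| = 1.
Hypothesis chi_faithful : forall x, chi x = 1 -> x = 0.

Local Notation q := (#|R|%:R : C).
Local Notation dot := (@ffun_dot R _).

Lemma charN x : chi (- x) = (chi x)^*.
Proof.
have e : chi (- x) * chi x = 1 by rewrite -chiD addNr chi0.
have := mulrC (chi x) (chi x)^*; rewrite -normCK norm_chi expr1n => e2.
have nz : chi x != 0 by rewrite -normr_gt0 norm_chi ltr01.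
by apply: (mulIf nz); rewrite e -e2.
Qed.

Lemma char_sum (I : finType) (F : I -> R) : chi (\sum_i F i) = \prod_i chi (F i).
Proof. exact: (big_morph chi chiD chi0). Qed.

(** Translation by [t0] permutes [J] and multiplies the sum by [chi (t0 * z)], which differs from 1
    by faithfulness. [J] will be the whole ring, an annihilator, or a double annihilator. *)
Lemma sum_char_eq0 (J : {set R}) (z t0 : R) :
  (forall t, (t + t0 \in J) = (t \in J)) -> t0 * z != 0 ->
  \sum_(t in J) chi (t * z) = 0.
Proof.
move=> Jt nz; set S := \sum_(t in J) _.
have : S = S * chi (t0 * z).
  rewrite {1}/S (reindex_inj (addIr t0)) /= /S mulr_suml.
  by apply: eq_big => [t|t _]; rewrite ?Jt // mulrDl chiD.
move/eqP; rewrite -{1}(mulr1 S) -subr_eq0 -mulrBr mulf_eq0 => /orP[/eqP //|].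
by rewrite subr_eq0 eq_sym => /eqP /chi_faithful /eqP; rewrite (negPf nz).
Qed.

Lemma sum_char z : \sum_t chi (t * z) = q * (z == 0)%:R.
Proof.
have [->|nz] := eqVneq z 0.
  rewrite mulr1 -[RHS]mulr1 mulr_natl -sumr_const.
  by apply: eq_bigr => t _; rewrite mulr0 chi0.
have <- : \sum_(t in [set: R]) chi (t * z) = \sum_t chi (t * z).
  by apply: eq_bigl => t; rewrite inE.
by rewrite mulr0; apply: (@sum_char_eq0 _ _ 1) => [t|]; rewrite ?inE ?mul1r.
Qed.

Definition fhat (e : R -> C) (t : R) : C := \sum_x e x * chi (t * x).

Lemma fhat0 e : fhat e 0 = \sum_x e x.
Proof. by apply: eq_bigr => x _; rewrite mul0r chi0 mulr1. Qed.

Lemma sum_prod_char N (e : 'I_N -> R -> C) (v : {ffun 'I_N -> R}) :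
  \sum_(y : {ffun 'I_N -> R}) \prod_i e i (y i) * chi (dot v y) =
  \prod_i fhat (e i) (v i).
Proof.
rewrite /fhat bigA_distr_bigA /=; apply: eq_bigr => y _.
by rewrite char_sum -big_split.
Qed.

Lemma sum_char_dot N (z : {ffun 'I_N -> R}) :
  \sum_(v : {ffun 'I_N -> R}) chi (dot v z) = q ^+ N * (z == 0)%:R.
Proof.
transitivity (\sum_(v : {ffun 'I_N -> R}) \prod_i chi (v i * z i)).
  by apply: eq_bigr => v _; rewrite char_sum.
rewrite -(bigA_distr_bigA (fun i x => chi (x * z i))).
under eq_bigr do rewrite sum_char.
rewrite big_split prodr_const card_ord; congr (_ * _).
have [->|nz] := eqVneq z 0; first by apply: big1 => i _; rewrite ffunE eqxx.
have [i zi|z0] := pickP (fun i => z i != 0); first by rewrite (bigD1 i) //= (negPf zi) mul0r.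
case/eqP: nz; apply/ffunP => i; rewrite ffunE; exact/eqP/negbFE/z0.
Qed.

Lemma dotBr N (v y z : {ffun 'I_N -> R}) : dot v (y - z) = dot v y - dot v z.
Proof. by rewrite -sumrB; apply: eq_bigr => i _; rewrite !ffunE mulrBr. Qed.

Lemma dotDr N (v y z : {ffun 'I_N -> R}) : dot v (y + z) = dot v y + dot v z.
Proof. by rewrite -big_split; apply: eq_bigr => i _; rewrite !ffunE mulrDr. Qed.

(** Only [H] is transformed with the conjugate character, so that the right-hand side is the
    bilinear pairing of a signed measure with a test function. *)
Lemma parseval N (phi H : {ffun 'I_N -> R} -> C) :
  \sum_v (\sum_y phi y * chi (dot v y)) * (\sum_y H y * (chi (dot v y))^*) =
  q ^+ N * \sum_y phi y * H y.
Proof.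
under eq_bigr => v _.
  rewrite mulr_suml; under eq_bigr do rewrite mulr_sumr.
  over.
rewrite exchange_big mulr_sumr; apply: eq_bigr => y _ /=.
rewrite exchange_big /= (bigD1 y) //= [X in _ + X]big1 ?addr0 => [|z zy].
  under eq_bigr do rewrite mulrACA -normCK norm_chi expr1n mulr1.
  rewrite sumr_const card_ffun card_ord -[in RHS]natrX mulr_natl //.
under eq_bigr do rewrite mulrACA -charN -chiD -dotBr.
by rewrite -mulr_sumr sum_char_dot subr_eq0 eq_sym (negPf zy) !mulr0.
Qed.

Lemma plancherel N (H : {ffun 'I_N -> R} -> C) :
  \sum_v `|\sum_y H y * (chi (dot v y))^*| ^+ 2 = q ^+ N * \sum_y `|H y| ^+ 2.
Proof.
transitivity (\sum_v (\sum_y (H y)^* * chi (dot v y)) * (\sum_y H y * (chi (dot v y))^*)).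
  apply: eq_bigr => v _; rewrite normCK mulrC rmorph_sum; congr (_ * _).
  by apply: eq_bigr => y _; rewrite rmorphM /= conjCK.
by rewrite parseval; congr (_ * _); apply: eq_bigr => y _; rewrite normCK mulrC.
Qed.

(** Translating by [w] multiplies the coefficient by the conjugate of [chi (dot v w)], which is not
    1. *)
Lemma fourier_invariant_eq0 N (H : {ffun 'I_N -> R} -> C) v w :
  (forall y, H (y + w) = H y) -> dot v w != 0 ->
  \sum_y H y * (chi (dot v y))^* = 0.
Proof.
move=> Hw nz; set S := \sum_y _.
have : S = S * (chi (dot v w))^*.
  rewrite {1}/S (reindex_inj (addIr w)) /= /S mulr_suml.
  by apply: eq_bigr => y _; rewrite Hw dotDr chiD rmorphM mulrA.
move/eqP; rewrite -{1}(mulr1 S) -subr_eq0 -mulrBr mulf_eq0 => /orP[/eqP //|].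
rewrite subr_eq0 -charN eq_sym => /eqP /chi_faithful /eqP.
by rewrite oppr_eq0 (negPf nz).
Qed.

Lemma card_finRing_gt0 : 0 < q.
Proof. by rewrite ltr0n; apply/card_gt0P; exists 0. Qed.

(** The frequency 0 cancels because both measures have mass 1, and invariance of [H] kills every [v]
    not orthogonal to all the [W l]. The parameter [tau] is free; it will be [s ^+ N]. *)
Lemma column_bound N (e : R -> C) (H : {ffun 'I_N -> R} -> C) (P : pred 'I_N)
    (W : 'I_N -> {ffun 'I_N -> R}) (tau : C) :
  \sum_x e x = 1 -> 0 < tau ->
  (forall y, `|H y| <= 1) ->
  (forall l, P l -> forall y, H (y + W l) = H y) ->
  `|\sum_(y : {ffun 'I_N -> R}) (\prod_i e (y i) - (q ^+ N)^-1) * H y| <=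
  ((\sum_(v : {ffun 'I_N -> R} | (v != 0) && [forall (l | P l), dot v (W l) == 0])
       \prod_i `|fhat e (v i)| ^+ 2) / tau + tau) / 2.
Proof.
move=> e1 t0 H1 HW; set D := bigop _ _ _; set S := bigop _ _ _.
have q0 : 0 < q ^+ N by rewrite exprn_gt0 // card_finRing_gt0.
pose phi (y : {ffun 'I_N -> R}) := \prod_i e (y i) - (q ^+ N)^-1.
pose ph v := \sum_y phi y * chi (dot v y).
pose Hh v := \sum_y H y * (chi (dot v y))^*.
have phE v : ph v = \prod_i fhat e (v i) - (v == 0)%:R.
  rewrite /ph /phi. under [LHS]eq_bigr => y _ do rewrite mulrBl.
  rewrite sumrB (sum_prod_char (fun=> e)) -mulr_sumr; congr (_ - _).
  transitivity ((q ^+ N)^-1 * \sum_y chi (dot y v)).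
    by congr (_ * _); apply: eq_bigr => y _; congr chi; apply: eq_bigr => i _; rewrite mulrC.
  by rewrite sum_char_dot mulrA mulVf ?mul1r // lt0r_neq0.
have ph0 : ph 0 = 0.
  by rewrite phE eqxx big1 ?subrr // => i _; rewrite ffunE fhat0.
have DE : q ^+ N * D =
    \sum_(v : {ffun 'I_N -> R} | (v != 0) && [forall (l | P l), dot v (W l) == 0])
      ph v * Hh v.
  rewrite -(parseval phi H) [RHS]big_mkcond; apply: eq_bigr => v _.
  case: ifP => // /negbT; rewrite negb_and negbK => /orP[/eqP-> |].
    by rewrite -/(ph 0) ph0 mul0r.
  case/forallPn => l; rewrite negb_imply => /andP[Pl dn].
  by rewrite (fourier_invariant_eq0 (HW l Pl) dn) mulr0.
(* AM-GM in place of Cauchy-Schwarz keeps the bound linear in the energy of [v],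
   so that it can be averaged over the columns [W]. *)
have AG (a b x : C) : 0 < x -> `|a * b| <= (`|a| ^+ 2 / x + x * `|b| ^+ 2) / 2.
  move=> x0; rewrite normrM ler_pdivlMr ?ltr0n // -subr_ge0.
  have -> : `|a| ^+ 2 / x + x * `|b| ^+ 2 - `|a| * `|b| * 2 =
     (`|a| - x * `|b|) ^+ 2 / x by field; rewrite lt0r_neq0.
  rewrite divr_ge0 ?(ltW x0) // -realEsqr realB ?rpredM ?normr_real //.
  exact: gtr0_real.
rewrite -(ler_pM2l q0) -{1}(gtr0_norm q0) -normrM DE.
apply: (le_trans (ler_norm_sum _ _ _)).
(* The weight [tau / q ^+ N] compensates the total energy of [Hh], which Plancherel bounds by
   [q ^+ (2 * N)]. *)
apply: (le_trans (ler_sum _ (fun v _ => AG _ _ (tau / q ^+ N) _))).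
  by move=> v _; rewrite divr_gt0.
rewrite -mulr_suml big_split /= -mulr_suml -mulr_sumr.
rewrite mulrA ler_pM2r ?invr_gt0 ?ltr0n // mulrDr; apply: lerD.
  rewrite le_eqVlt; apply/orP; left; apply/eqP.
  rewrite invfM invrK mulrA [in RHS]mulrA; rewrite mulrAC; congr (_ / _).
  rewrite mulrC; congr (_ * _); apply: eq_bigr => v /andP[v0 _].
  by rewrite phE (negPf v0) subr0 normr_prod prodrXl.
rewrite mulrAC -mulrA [leRHS]mulrC; apply: (ler_wpM2l (ltW t0)).
rewrite ler_pdivrMr //.
apply: (@le_trans _ _ (\sum_v `|Hh v| ^+ 2)).
  by rewrite [leLHS]big_mkcond; apply: ler_sum => v _; case: ifP => // _; rewrite exprn_ge0.
rewrite plancherel; apply: (ler_wpM2l (ltW q0)).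
rewrite -natrX -[leRHS]mulr1 mulr_natl.
have -> : (#|R| ^ N)%N = #|{: {ffun 'I_N -> R}}| by rewrite card_ffun card_ord.
by rewrite -sumr_const; apply: ler_sum => y _; rewrite expr_le1.
Qed.

End FiniteFourier.

(** * Annihilators and weights of vectors *)

Section Annihilators.

Variables (R : finComNzRingType) (N : nat).
Implicit Types v y : {ffun 'I_N -> R}.

Definition ffun_smul (t : R) v : {ffun 'I_N -> R} := [ffun i => t * v i].

Definition weight v : nat := #|[set i | v i != 0]|.

Definition ann v : {set R} := [set t | ffun_smul t v == 0].

(** The coordinates of [v] lie in [perp (ann v)], whose size is complementary to that of [ann v]. *)
Definition perp (J : {set R}) : {set R} := [set x | [forall t in J, t * x == 0]].

(** Over a ring with zero divisors a nonzero multiple of [v] can have far fewer nonzero coordinates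
    than [v], so the weight of [v] alone does not control the Fourier expansion of its orthogonality
    probability. *)
Definition multiples_heavy (d : nat) v : bool :=
  [forall t, (ffun_smul t v != 0) ==> (d < weight (ffun_smul t v))%N].

Lemma annP v t : reflect (forall i, t * v i = 0) (t \in ann v).
Proof.
rewrite inE; apply: (iffP eqP) => [e i|e].
  by have := congr1 (fun g : {ffun 'I_N -> R} => g i) e; rewrite !ffunE.
by apply/ffunP => i; rewrite !ffunE.
Qed.

Lemma perpP (J : {set R}) x : reflect (forall t, t \in J -> t * x = 0) (x \in perp J).
Proof. by rewrite inE; apply: (iffP forall_inP) => e t tJ; apply/eqP/e. Qed.

Lemma ann_addr v t t0 : t0 \in ann v -> (t + t0 \in ann v) = (t \in ann v).
Proof.
move=> /annP v0; apply/annP/annP => vt i; last by rewrite mulrDl v0 vt addr0.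
by have := vt i; rewrite mulrDl v0 addr0.
Qed.

Lemma perp_addr (J : {set R}) x x0 :
  x0 \in perp J -> (x + x0 \in perp J) = (x \in perp J).
Proof.
move=> /perpP J0; apply/perpP/perpP => Jx t tJ.
  by have := Jx t tJ; rewrite mulrDr J0 // addr0.
by rewrite mulrDr J0 // Jx // addr0.
Qed.

Lemma perp_ann v i : v i \in perp (ann v).
Proof. by apply/perpP => t /annP. Qed.

Lemma dot_scale t v y : ffun_dot (ffun_smul t v) y = t * ffun_dot v y.
Proof. by rewrite mulr_sumr; apply: eq_bigr => i _; rewrite ffunE mulrA. Qed.

Lemma ffun_neq0P v : reflect (exists i, v i != 0) (v != 0).
Proof.
apply: (iffP idP) => [v0|[i vi]]; last by apply: contraNneq vi => ->; rewrite ffunE.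
have [i vi|z] := pickP (fun i => v i != 0); first by exists i.
case/eqP: v0; apply/ffunP => i; rewrite ffunE; exact/eqP/negbFE/z.
Qed.

End Annihilators.

(** * The probability that a random column is orthogonal to [v] *)

Section OrthogonalityProbability.

Variables (C : numClosedFieldType) (R : finComNzRingType) (chi : R -> C).
Hypothesis chi0 : chi 0 = 1.
Hypothesis chiD : {morph chi : x y / x + y >-> x * y}.
Hypothesis norm_chi : forall x, `|chi x| = 1.
Hypothesis chi_faithful : forall x, chi x = 1 -> x = 0.

Local Notation q := (#|R|%:R : C).
Local Notation dot := (@ffun_dot R _).
Local Notation fhat := (fhat chi).

Definition orth_prob N (e : R -> C) (v : {ffun 'I_N -> R}) : C :=
  \sum_(y : {ffun 'I_N -> R}) \prod_i e (y i) * (dot v y == 0)%:R.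

Lemma orth_prob_fourier N (e : R -> C) (v : {ffun 'I_N -> R}) :
  q * orth_prob e v = \sum_t \prod_i fhat e (ffun_smul t v i).
Proof.
under [RHS]eq_bigr => t _ do rewrite -(sum_prod_char chi0 chiD (fun=> e)).
rewrite exchange_big mulr_sumr /=; apply: eq_bigr => y _.
rewrite mulrCA -(sum_char chi0 chiD chi_faithful) -mulr_sumr.
by congr (_ * _); apply: eq_bigr => t _; rewrite dot_scale.
Qed.

Lemma orth_prob_ge0 N (e : R -> C) (v : {ffun 'I_N -> R}) :
  (forall x, 0 <= e x) -> 0 <= orth_prob e v.
Proof. by move=> e0; apply: sumr_ge0 => y _; rewrite mulr_ge0 ?ler0n ?prodr_ge0. Qed.

(** In the Fourier expansion each [t] in [ann v] contributes at most 1, while any other [t] leaves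
    more than [d] nonzero coordinates, each costing a factor [rho]. *)
Lemma orth_prob_heavy N (e : R -> C) (v : {ffun 'I_N -> R}) (rho : C) d :
  (forall x, 0 <= e x) -> \sum_x e x = 1 -> 0 <= rho <= 1 ->
  (forall t, t != 0 -> `|fhat e t| <= rho) -> multiples_heavy d v ->
  orth_prob e v <= #|ann v|%:R / q * (1 + q * rho ^+ d.+1).
Proof.
move=> e0 e1 /andP[r0 r1] er /forallP hv.
have q0 : 0 < q := card_finRing_gt0 C R.
rewrite -(ler_pM2l q0) -(ger0_norm (mulr_ge0 (ltW q0) (orth_prob_ge0 v e0))).
rewrite orth_prob_fourier; apply: (le_trans (ler_norm_sum _ _ _)).
rewrite mulrA (mulrCA q) mulfV ?lt0r_neq0 // mulr1 mulrDr mulr1.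
have h1 t : `|fhat e t| <= 1.
  apply: (le_trans (ler_norm_sum _ _ _)); rewrite -e1; apply: ler_sum => x _.
  by rewrite normrM norm_chi mulr1 ger0_norm.
apply: (@le_trans _ _ (\sum_t ((t \in ann v)%:R + rho ^+ d.+1 * (t \notin ann v)%:R))).
  apply: ler_sum => t _; rewrite normr_prod inE.
  case: eqP => [->|/eqP nz] /=.
    rewrite mulr0 addr0 prodr_ile1 // => i _.
    by rewrite normr_ge0 h1.
  rewrite add0r mulr1.
  have := implyP (hv t) nz; set u := ffun_smul t v => du.
  rewrite (bigID (fun i => u i != 0)) /=.
  apply: (@le_trans _ _ (rho ^+ weight u * 1)).
    apply: ler_pM; rewrite ?prodr_ge0 //.
      rewrite /weight cardsE -prodr_const; apply: ler_prod => i ui.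
      by rewrite normr_ge0 er.
    by apply: prodr_ile1 => i _; rewrite normr_ge0 h1.
  by rewrite mulr1 ler_wiXn2l.
rewrite big_split /= -mulr_sumr; apply: lerD.
  by rewrite -natr_sum -big_mkcond sum1_card.
(* The error term is also given a factor [#|ann v|], so that the whole bound is a multiple of
   [#|ann v| / q], the form in which [sum_ann_energy] can absorb it. *)
have a1 : 1 <= #|ann v|%:R :> C.
  by rewrite ler1n; apply/card_gt0P; exists 0; apply/annP => i; rewrite mul0r.
apply: (@le_trans _ _ (q * rho ^+ d.+1)).
  rewrite mulrC; apply: ler_wpM2r; first by rewrite exprn_ge0.
  by rewrite -natr_sum -big_mkcond sum1_card ler_nat max_card.
by rewrite ler_peMl ?mulr_ge0 ?exprn_ge0 ?(ltW q0).
Qed.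

(** Double counting of the sum of [chi (t * x)] over [t] in [ann v] and all [x]: summing over [t]
    first detects [perp (ann v)], summing over [x] first detects [t = 0]. *)
Lemma card_ann_perp N (v : {ffun 'I_N -> R}) :
  #|ann v|%:R * #|perp (ann v)|%:R = q.
Proof.
have E (x : R) : \sum_(t in ann v) chi (t * x) = #|ann v|%:R * (x \in perp (ann v))%:R.
  have [/perpP xJ|xJ] := boolP (x \in perp _).
    rewrite mulr1 -sumr_const; by apply: eq_bigr => t tJ; rewrite xJ.
  rewrite mulr0; move: xJ; rewrite inE negb_forall_in => /exists_inP[t0 t0J nz].
  by apply: (sum_char_eq0 chiD chi_faithful _ nz) => t; rewrite ann_addr.
transitivity (\sum_x \sum_(t in ann v) chi (t * x)).
  under [RHS]eq_bigr do rewrite E.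
  by rewrite -mulr_sumr -natr_sum -big_mkcond sum1_card.
rewrite exchange_big /=.
under eq_bigr => t _ do under eq_bigr do rewrite mulrC.
under eq_bigr => t _ do rewrite (sum_char chi0 chiD chi_faithful).
rewrite (bigD1 0) /=; last by apply/annP => i; rewrite mul0r.
by rewrite eqxx mulr1 big1 ?addr0 // => t /andP[_ /negPf->]; rewrite mulr0.
Qed.

Variables (F : finType) (pi : R -> F).
Hypothesis mul_pi : forall t x y, t != 0 -> t * x = t * y -> pi x = pi y.

(** Here [pi] stands for reduction modulo [p], and [mul_pi] says that an equation [t * x = c] with
    [t != 0] fixes [x] modulo [p]. *)
Definition class_mass (e : R -> C) (f : F) : C := \sum_(x | pi x == f) e x.

(** Once every coordinate except one with [v j != 0] is fixed, the solutions for the remaining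
    coordinate lie in a single class of [pi]. *)
Lemma orth_prob_le N (e : R -> C) (v : {ffun 'I_N -> R}) (s : C) :
  (forall x, 0 <= e x) -> \sum_x e x = 1 -> 0 <= s ->
  (forall f, class_mass e f <= s) -> v != 0 -> orth_prob e v <= s.
Proof.
move=> e0 e1 s0 es /ffun_neq0P[j vj].
have -> : orth_prob e v = \sum_(y : {ffun 'I_N -> R})
    e (y j) * (\prod_(i | i != j) e (y i)) * (dot v y == 0)%:R.
  by apply: eq_bigr => y _; rewrite (bigD1 j).
rewrite (@sum_resample _ _ _ j (fun=> e) e) //.
have {1}-> : s = \sum_(w : {ffun 'I_N -> R}) \prod_i e (w i) * s.
  by rewrite -mulr_suml (sum_prod_ffun1 (c := fun=> e)) ?mul1r.
apply: ler_sum => w _. apply: ler_wpM2l; first by rewrite prodr_ge0.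
have [x xP|nx] := pickP (fun x => dot v (ffun_upd w j x) == 0); last first.
  by rewrite big1 // => x _; rewrite nx mulr0.
apply: le_trans (es (pi x)); rewrite /class_mass [leRHS]big_mkcond.
apply: ler_sum => y _; case: eqP => [yP|_]; last by rewrite mulr0; case: ifP.
rewrite mulr1; case: eqP => // /eqP/negP[]; apply/eqP.
have D z : dot v (ffun_upd w j z) = v j * z + \sum_(i | i != j) v i * w i.
  rewrite /ffun_dot (bigD1 j) //= ffun_updE eqxx; congr (_ + _).
  by apply: eq_bigr => i /negPf ij; rewrite ffun_updE ij.
apply: (mul_pi vj); apply: (addIr (\sum_(i | i != j) v i * w i)).
by rewrite -!D yP (eqP xP).
Qed.

(* A difference [x - y] killed by [perp (ann v)] is killed by the nonzero coordinates
   of [v], hence lies in the kernel of [pi]. *)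
Lemma perp_energy N (e : R -> C) (v : {ffun 'I_N -> R}) :
  (forall x, 0 <= e x) -> v != 0 ->
  \sum_(t in perp (ann v)) `|fhat e t| ^+ 2 <=
  #|perp (ann v)|%:R * \sum_f class_mass e f ^+ 2.
Proof.
move=> e0 /ffun_neq0P[j vj]; set I := perp _.
have E : \sum_(t in I) `|fhat e t| ^+ 2 =
    \sum_x \sum_y e x * e y * \sum_(t in I) chi (t * (x - y)).
  transitivity (\sum_(t in I) \sum_x \sum_y (e x * chi (t * x)) * (e y * chi (t * y))^*).
    apply: eq_bigr => t _; rewrite normCK rmorph_sum mulr_suml.
    by apply: eq_bigr => x _; rewrite mulr_sumr.
  rewrite exchange_big; apply: eq_bigr => x _ /=.
  rewrite exchange_big; apply: eq_bigr => y _ /=.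
  rewrite mulr_sumr; apply: eq_bigr => t _.
  rewrite rmorphM /= mulrACA -(charN chi0 chiD norm_chi) -chiD mulrBr.
  by congr (_ * _ * _); apply/CrealP; rewrite ger0_real.
have G x y : \sum_(t in I) chi (t * (x - y)) <= #|I|%:R * (pi x == pi y)%:R.
  have [t0 /andP[t0I nz]|z] := pickP (fun t => (t \in I) && (t * (x - y) != 0)).
    rewrite (sum_char_eq0 chiD chi_faithful _ nz) ?mulr_ge0 // => t.
    by rewrite perp_addr.
  have zI t : t \in I -> t * (x - y) = 0.
    by move=> tI; have := z t; rewrite tI /= => /negbFE/eqP.
  have -> : pi x = pi y.
    by apply: (mul_pi vj); apply/eqP; rewrite -subr_eq0 -mulrBr zI ?perp_ann.
  rewrite eqxx mulr1 -sumr_const; apply: ler_sum => t tI.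
  by rewrite zI // chi0.
rewrite E mulr_sumr.
have -> : \sum_f #|I|%:R * class_mass e f ^+ 2 =
    \sum_x \sum_y e x * e y * (#|I|%:R * (pi x == pi y)%:R).
  rewrite [RHS](partition_big pi xpredT) //=; apply: eq_bigr => f _.
  rewrite expr2 /class_mass mulr_suml mulr_sumr; apply: eq_bigr => x /eqP xf.
  rewrite [in LHS]mulr_sumr mulr_sumr [LHS]big_mkcond; apply: eq_bigr => y _.
  by rewrite xf [f == _]eq_sym; case: eqP => _; rewrite ?mulr1 ?mulr0 // mulrC.
apply: ler_sum => x _; apply: ler_sum => y _.
by apply: ler_wpM2l; rewrite ?mulr_ge0.
Qed.

(** The vectors are grouped by their annihilator [J]. Their coordinates lie in [perp J], so the
    group has energy at most [(#|perp J| * s2) ^+ N]; since [#|J| * #|perp J| = q], the weight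
    [(#|J| / q) ^+ N.-1] cancels all but one factor [#|perp J|]. *)
Lemma sum_ann_energy N (e : R -> C) :
  (0 < N)%N -> (forall x, 0 <= e x) ->
  \sum_(v : {ffun 'I_N -> R} | v != 0)
     \prod_i `|fhat e (v i)| ^+ 2 * (#|ann v|%:R / q) ^+ N.-1 <=
  2 ^+ #|R| * (q * (\sum_f class_mass e f ^+ 2) ^+ N).
Proof.
move=> N0 e0; set s2 := \sum_f _.
have q0 : 0 < q := card_finRing_gt0 C R.
have s20 : 0 <= s2.
  by apply: sumr_ge0 => f _; rewrite exprn_ge0 // sumr_ge0.
rewrite (partition_big (@ann R N) xpredT) //=.
(* The number of possible annihilators is bounded crudely by the number of subsets of [R]. *)
have -> : 2 ^+ #|R| * (q * s2 ^+ N) = \sum_(J : {set R}) q * s2 ^+ N.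
  have -> : \sum_(J : {set R}) q * s2 ^+ N = \sum_(J in powerset [set: R]) q * s2 ^+ N.
    by apply: eq_bigl => J; rewrite inE finset.subsetT.
  by rewrite sumr_const card_powerset cardsT -[RHS]mulr_natl natrX.
apply: ler_sum => J _.
have [v0 /andP[v0nz /eqP v0J]|none] :=
    pickP (fun v : {ffun 'I_N -> R} => (v != 0) && (ann v == J)); last first.
  by rewrite big_pred0 // mulr_ge0 ?exprn_ge0 // ltW.
apply: (@le_trans _ _ ((\sum_(t in perp J) `|fhat e t| ^+ 2) ^+ N * (#|J|%:R / q) ^+ N.-1)).
  have -> : (\sum_(t in perp J) `|fhat e t| ^+ 2) ^+ N =
      \sum_(v : {ffun 'I_N -> R}) \prod_i (if v i \in perp J then `|fhat e (v i)| ^+ 2 else 0).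
    rewrite -(bigA_distr_bigA (fun _ t => if t \in perp J then `|fhat e t| ^+ 2 else 0)).
    by rewrite prodr_const card_ord -big_mkcond.
  rewrite mulr_suml [leLHS]big_mkcond; apply: ler_sum => v _.
  have g0 : 0 <= (#|J|%:R / q) ^+ N.-1 by rewrite exprn_ge0 // divr_ge0 // ltW.
  case: ifP => [/andP[_ /eqP vJ]|_]; last first.
    by rewrite mulr_ge0 // prodr_ge0 // => i _; case: ifP => // _; rewrite exprn_ge0.
  rewrite vJ; apply: ler_wpM2r => //; apply: ler_prod => i _.
  by rewrite exprn_ge0 //= -vJ perp_ann.
have cJ : #|J|%:R * #|perp J|%:R = q by rewrite -v0J card_ann_perp.
apply: (@le_trans _ _ ((#|perp J|%:R * s2) ^+ N * (#|J|%:R / q) ^+ N.-1)).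
  apply: ler_wpM2r; first by rewrite exprn_ge0 // divr_ge0 // ltW.
  apply: lerXn2r; rewrite ?nnegrE ?mulr_ge0 //; last by rewrite -v0J; exact: perp_energy.
  by apply: sumr_ge0 => t _; rewrite exprn_ge0.
have -> : (#|perp J|%:R * s2) ^+ N * (#|J|%:R / q) ^+ N.-1 = #|perp J|%:R * s2 ^+ N.
  rewrite exprMn mulrAC -{1}(prednK N0) exprS -[_ * _ * (_ / q) ^+ _]mulrA -exprMn.
  by rewrite mulrA [_ * #|J|%:R]mulrC cJ mulfV ?lt0r_neq0 // expr1n mulr1.
by apply: ler_wpM2r; rewrite ?exprn_ge0 // ler_nat max_card.
Qed.

End OrthogonalityProbability.

(** * Replacing the columns of one matrix *)

Section ColumnReplacement.

Variables (C : numClosedFieldType) (R : finComNzRingType) (chi : R -> C).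
Hypothesis chi0 : chi 0 = 1.
Hypothesis chiD : {morph chi : x y / x + y >-> x * y}.
Hypothesis norm_chi : forall x, `|chi x| = 1.
Hypothesis chi_faithful : forall x, chi x = 1 -> x = 0.
Variables (F : finType) (pi : R -> F).
Hypothesis mul_pi : forall t x y, t != 0 -> t * x = t * y -> pi x = pi y.

Local Notation q := (#|R|%:R : C).
Local Notation dot := (@ffun_dot R _).
Local Notation fhat := (fhat chi).
Local Notation unif := ((fun=> q^-1) : R -> C).
Local Notation col N := {ffun 'I_N -> R}.

Lemma sum_unif : \sum_(x : R) unif x = 1.
Proof. by rewrite sumr_const -[LHS]mulr_natl mulfV // lt0r_neq0 // card_finRing_gt0. Qed.

Lemma fhat_unif t : t != 0 -> fhat unif t = 0.
Proof.
move=> t0; rewrite /fhat -mulr_sumr; under eq_bigr do rewrite mulrC.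
by rewrite (sum_char chi0 chiD chi_faithful) (negPf t0) !mulr0.
Qed.

(** Independence of the columns. Column [j] is left unconstrained, as it is the one being
    replaced. *)
Lemma sum_orthogonal N (E : 'I_N -> R -> C) (v : col N) (j : 'I_N) :
  (forall l, \sum_x E l x = 1) ->
  \sum_(w : {ffun 'I_N -> col N}) \prod_l \prod_i E l (w l i) *
     [forall (l | l != j), dot v (w l) == 0]%:R =
  \prod_(l | l != j) orth_prob (E l) v.
Proof.
move=> E1.
pose g l (y : col N) := \prod_i E l (y i) * (if l != j then (dot v y == 0)%:R else 1).
transitivity (\sum_(w : {ffun 'I_N -> col N}) \prod_l g l (w l)).
  apply: eq_bigr => w _; rewrite /g big_split /=; congr (_ * _).
  rewrite -big_mkcond /=; case: forall_inP => [z|nz].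
    by rewrite big1 // => l lj; rewrite z.
  have [l /andP[lj dl]|none] := pickP (fun l => (l != j) && (dot v (w l) != 0)).
    by rewrite (bigD1 l) //= (negPf dl) mul0r.
  by case: nz => l lj; have := none l; rewrite lj /= => /negbFE.
rewrite -(bigA_distr_bigA g) (bigD1 j) //= /g eqxx /=.
under eq_bigr do rewrite mulr1.
rewrite (sum_prod_ffun1 (c := fun=> E j)) // mul1r.
by apply: eq_bigr => l lj; rewrite lj.
Qed.

Definition light_vectors N d : {set col N} := [set v : col N | (v != 0) && (weight v <= d)%N].

(** At step [j] the earlier columns have entries of law [xi] and the later ones are uniform. The
    [N.-1] columns other than [j] give the exponent in the light term, and [column_bound] with
    [tau = s ^+ N] gives the other term after averaging over them. *)
Lemma columns_step N (xi : R -> C) (H : {ffun 'I_N -> col N} -> C) (s rho : C) d :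
  (0 < N)%N -> (forall x, 0 <= xi x) -> \sum_x xi x = 1 ->
  0 <= rho <= 1 -> (forall t, t != 0 -> `|fhat xi t| <= rho) ->
  0 < s -> \sum_f class_mass pi xi f ^+ 2 = s ^+ 2 ->
  (forall f, class_mass pi unif f <= s) ->
  (forall w, `|H w| <= 1) ->
  (forall w j l, l != j -> H (ffun_upd w j (w j + w l)) = H w) ->
  `|\sum_(w : {ffun 'I_N -> col N})
      (\prod_j \prod_i xi (w j i) - \prod_(j < N) \prod_(i < N) q^-1) * H w| <=
  N%:R * (2 * #|light_vectors N d|%:R * s ^+ N.-1 +
    (2 ^+ #|R| * q * (1 + q * rho ^+ d.+1) ^+ N.-1 + 1) / 2 * s ^+ N).
Proof.
move=> N0 xi0 xi1 rho01 xir s0 xis us H1 Hadd.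
have q0 : 0 < q := card_finRing_gt0 C R.
have u0 x : 0 <= unif x by rewrite invr_ge0 ltW.
have xic f : class_mass pi xi f <= s.
  rewrite -(ler_pXn2r (n := 2)) ?nnegrE ?(ltW s0) // -?xis ?sumr_ge0 //.
  rewrite (bigD1 f) //= lerDl sumr_ge0 // => f' _.
  by rewrite exprn_ge0 // sumr_ge0.
set B := 1 + q * rho ^+ d.+1.
have B0 : 0 <= B.
  by case/andP: rho01 => r0 _; rewrite addr_ge0 // mulr_ge0 ?exprn_ge0 ?(ltW q0).
pose Pc (_ : 'I_N) (y : col N) := \prod_i xi (y i).
pose Qc (_ : 'I_N) (y : col N) := \prod_(i < N) q^-1.
have P1 l : \sum_y Pc l y = 1 by apply: (sum_prod_ffun1 (c := fun=> xi)).
have Q1 l : \sum_y Qc l y = 1.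
  by apply: (sum_prod_ffun1 (c := fun=> unif)) => _; exact: sum_unif.
rewrite (sum_hybrid (P := Pc) (Q := Qc)) //.
apply: (le_trans (ler_norm_sum _ _ _)).
have -> : N%:R * (2 * #|light_vectors N d|%:R * s ^+ N.-1 +
    (2 ^+ #|R| * q * B ^+ N.-1 + 1) / 2 * s ^+ N) =
  \sum_(j < N) (2 * #|light_vectors N d|%:R * s ^+ N.-1 +
    (2 ^+ #|R| * q * B ^+ N.-1 + 1) / 2 * s ^+ N).
  by rewrite sumr_const card_ord mulr_natl.
apply: ler_sum => j _; apply: (le_trans (ler_norm_sum _ _ _)).
pose E (l : 'I_N) : R -> C := if (l < j)%N then xi else unif.
have E0 l x : 0 <= E l x by rewrite /E; case: ifP => _; [exact: xi0 | exact: u0].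
have E1 l : \sum_x E l x = 1 by rewrite /E; case: ifP => // _; exact: sum_unif.
have Er l t : t != 0 -> `|fhat (E l) t| <= rho.
  rewrite /E; case: ifP => _ t0; first exact: xir.
  by rewrite fhat_unif // normr0; case/andP: rho01.
have Es l f : class_mass pi (E l) f <= s by rewrite /E; case: ifP.
pose orth (v : col N) (w : {ffun 'I_N -> col N}) := [forall (l | l != j), dot v (w l) == 0].
pose G (v : col N) := \prod_i `|fhat xi (v i)| ^+ 2.
have G0 v : 0 <= G v by apply: prodr_ge0 => i _; rewrite exprn_ge0.
pose heavy (v : col N) := (v != 0) && multiples_heavy d v.
(* [X w] bounds the error for fixed columns [w] in both cases: the trivial bound 2 when some light
   vector is orthogonal to the other columns, the Fourier bound otherwise. *)
pose X w := \sum_(v in light_vectors N d) 2 * (orth v w)%:R +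
  (\sum_(v | heavy v) G v * (orth v w)%:R / s ^+ N + s ^+ N) / 2.
apply: (@le_trans _ _ (\sum_(w : {ffun 'I_N -> col N}) \prod_l \prod_i E l (w l i) * X w)).
  apply: ler_sum => w _; rewrite normrM.
  have -> : \prod_(i < N) (if (i < j)%N then Pc i else Qc i) (w i) = \prod_l \prod_i E l (w l i).
    by apply: eq_bigr => l _; rewrite /E; case: ifP.
  have EE : 0 <= \prod_l \prod_i E l (w l i) by apply: prodr_ge0 => l _; apply: prodr_ge0.
  rewrite ger0_norm //; apply: ler_wpM2l => //.
  have X1 : 0 <= \sum_(v in light_vectors N d) 2 * (orth v w)%:R :> C.
    by apply: sumr_ge0 => v _; rewrite mulr_ge0.
  have X2 : 0 <= (\sum_(v | heavy v) G v * (orth v w)%:R / s ^+ N + s ^+ N) / 2.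
    rewrite divr_ge0 // addr_ge0 ?exprn_ge0 ?(ltW s0) // sumr_ge0 // => v _.
    by rewrite !mulr_ge0 ?invr_ge0 ?exprn_ge0 ?(ltW s0).
  have [v /andP[vl vo]|none] := pickP (fun v => (v \in light_vectors N d) && orth v w).
    apply: (@le_trans _ _ 2); last first.
      rewrite /X -[leLHS]addr0 lerD // (bigD1 v) //= vo mulr1 lerDl.
      by apply: sumr_ge0 => u _; rewrite mulr_ge0.
    apply: (le_trans (ler_norm_sum _ _ _)).
    apply: (@le_trans _ _ (\sum_y (Pc j y + Qc j y))).
      apply: ler_sum => y _; rewrite normrM -[leRHS]mulr1.
      apply: ler_pM => //; apply: (le_trans (ler_normB _ _)).
      by rewrite !ger0_norm //; apply: prodr_ge0 => i _; first [exact: xi0 | exact: (u0 0)].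
    by rewrite big_split /= P1 Q1.
  rewrite /X -[leLHS]add0r; apply: lerD => //.
  have cb := @column_bound C R chi chi0 chiD norm_chi chi_faithful N xi
     (fun y => H (ffun_upd w j y)) (fun l => l != j) w (s ^+ N) xi1
     (exprn_gt0 _ s0) (fun y => H1 _).
  have QE y : Qc j y = (q ^+ N)^-1 by rewrite /Qc prodr_const card_ord exprVn.
  under eq_bigr do rewrite QE.
  apply: (le_trans (cb _)) => [l lj y|].
    have := Hadd (ffun_upd w j y) j l lj; rewrite !ffun_updE eqxx (negPf lj) => <-.
    congr H; apply/ffunP => i; rewrite !ffun_updE; case: eqP => //.
  rewrite ler_pM2r ?invr_gt0 // lerD2r -mulr_suml ler_pM2r ?invr_gt0 ?exprn_gt0 //.
  rewrite [leLHS]big_mkcond [leRHS]big_mkcond; apply: ler_sum => v _ /=.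
  case: ifP => [/andP[v0 vo]|_]; last first.
    by case: ifP => // _; rewrite mulr_ge0.
  (* Multiples of an orthogonal vector are orthogonal, so a light nonzero multiple of [v] would be a
     light orthogonal vector, which this case excludes. *)
  suff -> : heavy v by rewrite (_ : orth v w) // mulr1.
  rewrite /heavy v0 /=; apply/forallP => t; apply/implyP => tv.
  rewrite ltnNge; apply/negP => tl.
  have := none (ffun_smul t v); rewrite inE tv tl /=; case/negP.
  apply/forall_inP => l lj; rewrite dot_scale.
  by move/forall_inP: vo => /(_ l lj)/eqP->; rewrite mulr0.
have EX v : \sum_(w : {ffun 'I_N -> col N}) \prod_l \prod_i E l (w l i) * (orth v w)%:R =
    \prod_(l | l != j) orth_prob (E l) v by exact: sum_orthogonal.
have cardj : #|[pred l : 'I_N | l != j]| = N.-1.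
  by have := cardC (pred1 j); rewrite card1 card_ord add1n => e; rewrite -[in RHS]e.
have EP1 : \sum_(w : {ffun 'I_N -> col N}) \prod_l \prod_i E l (w l i) = 1.
  by apply: (sum_prod_ffun1 (c := fun l (y : col N) => \prod_i E l (y i))) => l;
    apply: (sum_prod_ffun1 (c := fun=> E l)).
have -> : \sum_(w : {ffun 'I_N -> col N}) \prod_l \prod_i E l (w l i) * X w =
   \sum_(v in light_vectors N d) 2 * \prod_(l | l != j) orth_prob (E l) v +
   ((\sum_(v | heavy v) G v * \prod_(l | l != j) orth_prob (E l) v) / s ^+ N + s ^+ N) / 2.
  rewrite /X; under eq_bigr => w _ do rewrite mulrDr (mulrA _ _ 2^-1) mulrDr.
  rewrite big_split /= -mulr_suml big_split /= -mulr_suml EP1 mul1r.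
  congr (_ + (_ + _) / _).
    under eq_bigr do rewrite mulr_sumr.
    rewrite exchange_big /=; apply: eq_bigr => v _.
    by rewrite -EX mulr_sumr; apply: eq_bigr => w _; rewrite mulrCA.
  under eq_bigr do rewrite mulr_sumr.
  rewrite exchange_big mulr_suml /=; apply: eq_bigr => v _.
  rewrite -EX mulr_sumr mulr_suml; apply: eq_bigr => w _.
  by rewrite !mulrA [_ * G v]mulrC.
apply: lerD.
  rewrite -mulr_sumr -[leRHS]mulrA ler_pM2l // mulr_natl -sumr_const.
  apply: ler_sum => v; rewrite inE => /andP[v0 _].
  rewrite -cardj -prodr_const; apply: ler_prod => l _.
  by rewrite orth_prob_ge0 //= (orth_prob_le mul_pi) // ltW.
have sN : 0 < s ^+ N by rewrite exprn_gt0.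
rewrite mulrAC ler_pM2r ?invr_gt0 // mulrDl mul1r lerD2r ler_pdivrMr //.
(* Heaviness is used in the orthogonality bound and then dropped, leaving the sum over all nonzero
   [v] to [sum_ann_energy]. *)
apply: (@le_trans _ _ (\sum_(v : col N | v != 0) G v * (#|ann v|%:R / q) ^+ N.-1 * B ^+ N.-1)).
  rewrite [leLHS]big_mkcond [leRHS]big_mkcond; apply: ler_sum => v _ /=.
  have a0 : 0 <= #|ann v|%:R / q by rewrite divr_ge0 ?ler0n.
  rewrite /heavy; case: eqP => //= _; case: ifP => [hv|_]; last first.
    by rewrite !mulr_ge0 ?exprn_ge0.
  rewrite -mulrA; apply: ler_wpM2l => //; rewrite -exprMn -cardj -prodr_const.
  apply: ler_prod => l _; rewrite orth_prob_ge0 //=.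
  by apply: (orth_prob_heavy chi0 chiD norm_chi chi_faithful) hv => // t; apply: Er.
have BB : 0 <= B ^+ N.-1 by rewrite exprn_ge0.
have en := @sum_ann_energy C R chi chi0 chiD norm_chi chi_faithful F pi mul_pi N xi N0 xi0.
rewrite -mulr_suml mulrC; apply: (le_trans (ler_wpM2l BB en)).
rewrite xis -exprM mulnC exprM expr2 le_eqVlt; apply/orP; left; apply/eqP.
by set b := B ^+ _; set c := 2 ^+ _; ring.
Qed.

End ColumnReplacement.

(** * Transvections, and the passage from columns to matrices *)

Lemma det_transvection (A : comNzRingType) (n : nat) (i j : 'I_n) :
  i != j -> \det (1%:M + delta_mx i j : 'M[A]_n) = 1.
Proof.
(* By linearity in row [i], the determinant is that of the identity plus that of [B], whose rows [i]
   and [j] coincide. *)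
move=> ij; pose B : 'M[A]_n := \matrix_(k, l) (if k == i then (l == j)%:R else (k == l)%:R).
rewrite (@determinant_multilinear _ _ _ 1%:M B i 1 1).
- rewrite det1 (@determinant_alternate _ _ B i j) // ?mulr0 ?mulr1 ?addr0 // => l.
  by rewrite !mxE eqxx [j == i]eq_sym (negPf ij) [l == j]eq_sym.
- by rewrite !scale1r; apply/rowP => l; rewrite !mxE !eqxx.
- by apply/matrixP => k l; rewrite !mxE [_ == i]eq_sym (negPf (neq_lift _ _)) addr0.
- apply/matrixP => k l; rewrite !mxE [_ == i]eq_sym (negPf (neq_lift _ _)).
  by rewrite addr0.
Qed.

Definition mx_of_cols (R : Type) (N : nat) (w : {ffun 'I_N -> {ffun 'I_N -> R}}) : 'M[R]_N :=
  \matrix_(i, j) w j i.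

Lemma mx_of_cols_bij (R : Type) N : bijective (@mx_of_cols R N).
Proof.
exists (fun A : 'M[R]_N => [ffun j => [ffun i => A i j]]) => [w|A].
  by apply/ffunP => j; apply/ffunP => i; rewrite !ffunE mxE.
by apply/matrixP => i j; rewrite mxE !ffunE.
Qed.

Lemma mx_of_cols_add (R : nzRingType) N (w : {ffun 'I_N -> {ffun 'I_N -> R}}) j l :
  mx_of_cols (ffun_upd w j (w j + w l)) = mx_of_cols w *m (1%:M + delta_mx l j).
Proof.
apply/matrixP => i k; rewrite mulmxDr mulmx1 !mxE ffun_updE.
rewrite (bigD1 l) //= big1 ?addr0 => [|l' /negPf ll']; last first.
  by rewrite !mxE ll' mulr0.
rewrite !mxE eqxx /=; case: eqP => [->|_]; last by rewrite mulr0 addr0.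
by rewrite ffunE mulr1.
Qed.

Section MatrixStep.

Variables (K : realType) (R : finComNzRingType) (chi : R -> K[i]).
Hypothesis chi0 : chi 0 = 1.
Hypothesis chiD : {morph chi : x y / x + y >-> x * y}.
Hypothesis norm_chi : forall x, `|chi x| = 1.
Hypothesis chi_faithful : forall x, chi x = 1 -> x = 0.
Variables (F : finType) (pi : R -> F).
Hypothesis mul_pi : forall t x y, t != 0 -> t * x = t * y -> pi x = pi y.

(** Right multiplication by a transvection adds one column to another, so [SL_N]-invariance supplies
    the column invariance in [columns_step]. All quantities are real and are moved between [K] and
    [K[i]]. *)
Lemma matrix_step N (xi : R -> K) (h : 'M[R]_N -> K) (s rho : K) d :
  (0 < N)%N -> (forall x, 0 <= xi x) -> \sum_x xi x = 1 ->
  0 <= rho <= 1 ->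
  (forall t, t != 0 -> `|fhat chi (fun x => (xi x)%:C%C) t| <= rho%:C%C) ->
  0 < s -> \sum_f (\sum_(x | pi x == f) xi x) ^+ 2 = s ^+ 2 ->
  (forall f, \sum_(x | pi x == f) #|R|%:R^-1 <= s) ->
  (forall A, `|h A| <= 1) -> SL_right_invariant h ->
  `|\sum_(A : 'M[R]_N) (iid_mx_pmf xi A - unif_mx_pmf K A) * h A| <=
  N%:R * (2 * #|light_vectors R N d|%:R * s ^+ N.-1 +
    (2 ^+ #|R| * #|R|%:R * (1 + #|R|%:R * rho ^+ d.+1) ^+ N.-1 + 1) / 2 * s ^+ N).
Proof.
move=> N0 xi0 xi1 /andP[rho0 rho1] xir s0 xis us h1 hinv.
pose H (w : {ffun 'I_N -> {ffun 'I_N -> R}}) : K[i] := (h (mx_of_cols w))%:C%C.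
have cast_norm (x : K) : `|x%:C%C| = `|x|%:C%C :> K[i].
  have [x0|x0] := leP 0 x; first by rewrite !ger0_norm ?ler0c.
  by rewrite !ltr0_norm ?ltcR // rmorphN.
have := @columns_step K[i] R chi chi0 chiD norm_chi chi_faithful F pi mul_pi N
  (fun x => (xi x)%:C%C) H s%:C%C rho%:C%C d N0.
have -> : \sum_(w : {ffun 'I_N -> {ffun 'I_N -> R}})
     (\prod_j \prod_i (xi (w j i))%:C%C - \prod_(j < N) \prod_(i < N) #|R|%:R^-1) * H w =
   (\sum_(A : 'M[R]_N) (iid_mx_pmf xi A - unif_mx_pmf K A) * h A)%:C%C :> K[i].
  rewrite rmorph_sum (reindex _ (onW_bij _ (mx_of_cols_bij R N))) /=.
  apply: eq_bigr => w _; rewrite rmorphM rmorphB /=; congr ((_ - _) * _).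
    rewrite /iid_mx_pmf exchange_big rmorph_prod; apply: eq_bigr => j _ /=.
    by rewrite rmorph_prod; apply: eq_bigr => i _; rewrite mxE.
  rewrite /unif_mx_pmf card_mx !prodr_const card_ord fmorphV rmorph_nat natrX.
  by rewrite -exprM exprVn.
rewrite cast_norm => st; rewrite -lecR; apply: le_trans (st _ _ _ _ _ _ _ _ _) _.
- by move=> x; rewrite ler0c.
- by rewrite -rmorph_sum xi1 rmorph1.
- by rewrite ler0c rho0 -(rmorph1 (real_complex K)) lecR.
- exact: xir.
- by rewrite ltcR.
- rewrite -rmorphXn -xis rmorph_sum; apply: eq_bigr => f _.
  by rewrite rmorphXn /class_mass rmorph_sum.
- by move=> f; have := us f; rewrite -lecR rmorph_sum fmorphV rmorph_nat.
- by move=> w; rewrite /H cast_norm -(rmorph1 (real_complex K)) lecR.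
- by move=> w j l lj; rewrite /H mx_of_cols_add hinv // det_transvection.
rewrite le_eqVlt; apply/orP; left; apply/eqP.
by rewrite !(rmorphM, rmorphD, rmorphXn, rmorph_nat, rmorph1, fmorphV).
Qed.

End MatrixStep.

(** * Replacing the matrices of the chain *)

(** The factor [g] moves from the end of factor [j] to the front of factor [j.+1], so only the
    partial product that stops between them changes. *)
Lemma prod_nat_absorb (R : comNzRingType) N (g : 'M[R]_N) (j : nat) (W1 W2 : nat -> 'M[R]_N) :
  W1 j = W2 j *m g -> W2 j.+1 = g *m W1 j.+1 ->
  (forall l, l != j -> l != j.+1 -> W1 l = W2 l) ->
  forall n, \prod_(l < n) W1 l = \prod_(l < n) W2 l *m (if n == j.+1 then g else 1%:M).
Proof.
move=> Wj Wj1 Wl; elim=> [|n IHn]; first by rewrite !big_ord0 mulmx1.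
rewrite !big_ord_recr /= IHn.
have [->|nj] := eqVneq n j.
  by rewrite eqxx (ltn_eqF (ltnSn j)) mulmx1 Wj; apply: mulmxA.
rewrite eqSS (negPf nj) mulmx1.
have [->|nj1] := eqVneq n j.+1; first by rewrite Wj1; symmetry; apply: mulmxA.
by rewrite mulmx1 Wl.
Qed.

Lemma product_chain_absorb (R : comNzRingType) N (T : Type) (f : 'M[R]_N -> T) k
    (j : 'I_k) (g : 'M[R]_N) (w1 w2 : {ffun 'I_k -> 'M[R]_N}) :
  SL_right_invariant f -> \det g = 1 ->
  w1 j = w2 j *m g -> (forall l : 'I_k, l = j.+1 :> nat -> w2 l = g *m w1 l) ->
  (forall l : 'I_k, l != j -> l != j.+1 :> nat -> w1 l = w2 l) ->
  product_chain f w1 = product_chain f w2.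
Proof.
move=> finv g1 wj wj1 wl; apply/ffunP => i; rewrite !ffunE.
(* If [j] is the last factor, its factor [g] is absorbed by the padding at [j.+1]. *)
pose X (w : {ffun 'I_k -> 'M[R]_N}) (c : 'M[R]_N) n :=
  if insub n is Some l then w l else if n == j.+1 then c else 1%:M.
have E (w : {ffun 'I_k -> 'M[R]_N}) c : \prod_(l < k | (l <= i)%N) w l = \prod_(l < i.+1) X w c l.
  rewrite (big_ord_widen k (X w c) (ltn_ord i)); apply: eq_bigr => l _.
  by rewrite /X valK.
rewrite (E w1 1%:M) (E w2 g).
rewrite (@prod_nat_absorb _ _ g j (X w1 1%:M) (X w2 g)).
- by case: ifP => _; rewrite ?mulmx1 // finv.
- by rewrite /X valK wj.
- rewrite /X; case: insubP => [l _ lj|_]; first by rewrite wj1.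
  by rewrite eqxx mulmx1.
- move=> l lj lj1; rewrite /X; case: insubP => [l' _ l'l|_]; last by rewrite (negPf lj1).
  by apply: wl; rewrite -?val_eqE l'l.
Qed.

Lemma sum_unif_mx (K : realType) (R : finComNzRingType) N :
  \sum_(A : 'M[R]_N) unif_mx_pmf K A = 1.
Proof.
rewrite sumr_const -[LHS]mulr_natl mulfV // pnatr_eq0 -lt0n.
by apply/card_gt0P; exists 0.
Qed.

(** At step [j] the matrices after the [j]-th are uniform. Averaging over all the others gives a
    function [h] of the [j]-th matrix alone, and the one-matrix bound [D] applies once [h] is shown
    to be invariant. *)
Lemma chain_step (K : realType) (R : finComNzRingType) N (T : Type) (f : 'M[R]_N -> T)
    k (mu : 'M[R]_N -> K) (D : K) (V : {ffun 'I_k -> T} -> bool) :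
  (forall A, 0 <= mu A) -> \sum_A mu A = 1 ->
  (forall h : 'M[R]_N -> K, (forall A, `|h A| <= 1) -> SL_right_invariant h ->
     `|\sum_A (mu A - unif_mx_pmf K A) * h A| <= D) ->
  SL_right_invariant f ->
  `|\sum_(w : {ffun 'I_k -> 'M[R]_N}) (iid_pmf mu w - iid_pmf (@unif_mx_pmf K R N) w)
      * (V (product_chain f w))%:R| <= k%:R * D.
Proof.
move=> mu0 mu1 muD finv; set u := @unif_mx_pmf K R N.
have u0 A : 0 <= u A by rewrite invr_ge0.
rewrite (sum_hybrid (P := fun=> mu) (Q := fun=> u)) //; last first.
  by move=> _; exact: sum_unif_mx.
apply: (le_trans (ler_norm_sum _ _ _)).
have -> : k%:R * D = \sum_(j < k) D by rewrite sumr_const card_ord mulr_natl.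
apply: ler_sum => j _.
pose c (w : {ffun 'I_k -> 'M[R]_N}) := \prod_(i < k) (if (i < j)%N then mu else u) (w i).
have c0 w : 0 <= c w by apply: prodr_ge0 => i _; case: ifP.
have c1 : \sum_w c w = 1.
  apply: (sum_prod_ffun1 (c := fun i : 'I_k => if (i < j)%N then mu else u)) => i.
  by case: ifP => // _; exact: sum_unif_mx.
pose h (A : 'M[R]_N) := \sum_w c w * (V (product_chain f (ffun_upd w j A)))%:R.
have -> : \sum_(w : {ffun 'I_k -> 'M[R]_N}) \prod_(i < k) (if (i < j)%N then mu else u) (w i)
     * \sum_A (mu A - u A) * (V (product_chain f (ffun_upd w j A)))%:R =
  \sum_A (mu A - u A) * h A.
  under eq_bigr do rewrite mulr_sumr.
  rewrite exchange_big /=; apply: eq_bigr => A _; rewrite mulr_sumr.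
  by apply: eq_bigr => w _; rewrite mulrCA.
apply: muD => [A|A g g1].
  rewrite /h ger0_norm; last by apply: sumr_ge0 => w _; rewrite mulr_ge0.
  rewrite -[leRHS]c1; apply: ler_sum => w _; rewrite -[leRHS]mulr1.
  by apply: ler_wpM2l => //; case: (V _).
(* The change of variables multiplies the factor after [j] by [g] on the left; if [j] is the last
   index, it is the identity. *)
pose G (g : 'M[R]_N) (w : {ffun 'I_k -> 'M[R]_N}) :=
  [ffun l : 'I_k => if l == j.+1 :> nat then g *m w l else w l].
have GK : cancel (G g) (G (\adj g)).
  move=> w; apply/ffunP => l; rewrite !ffunE; case: eqP => // _.
  by rewrite mulmxA mul_adj_mx g1 mul1mx.
have KG : cancel (G (\adj g)) (G g).
  move=> w; apply/ffunP => l; rewrite !ffunE; case: eqP => // _.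
  by rewrite mulmxA mul_mx_adj g1 mul1mx.
rewrite /h [RHS](reindex (G g)) /=; last by apply: onW_bij; exists (G (\adj g)).
apply: eq_bigr => w _; congr (_ * _).
  (* The index [j.+1] is not below [j], so its weight is the constant [u], which is unchanged. *)
  apply: eq_bigr => l _; rewrite ffunE; case: eqP => // ->.
  by rewrite ltnNge leqnSn.
rewrite (@product_chain_absorb _ _ _ f k j g _ (ffun_upd (G g w) j A)) //.
- by rewrite !ffunE eqxx.
- move=> l lj; rewrite !ffunE -val_eqE /= lj eqxx.
  by rewrite (gtn_eqF (ltnSn j)).
- by move=> l /negPf lj /negPf lj1; rewrite !ffunE lj lj1.
Qed.

(** * Counting vectors of small weight *)

(** A Chernoff-type count: the right-hand side expands into a sum over all [v] in which a nonzero
    coordinate contributes [x] and a zero one at least 1, so each light [v] contributes at least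
    [x ^+ d]. *)
Lemma card_light_vectors (K : realFieldType) (R : finComNzRingType) N d (x : K) :
  0 < x <= 1 -> #|light_vectors R N d|%:R * x ^+ d <= (1 + #|R|%:R * x) ^+ N.
Proof.
move=> /andP[x0 x1].
have -> : (1 + #|R|%:R * x) ^+ N =
    \sum_(v : {ffun 'I_N -> R}) \prod_i ((v i == 0)%:R + x).
  rewrite -(bigA_distr_bigA (fun _ t => (t == 0)%:R + x)) prodr_const card_ord.
  congr (_ ^+ _); rewrite big_split /= sumr_const; congr (_ + _); last by rewrite mulr_natl.
  by rewrite (bigD1 0) //= eqxx big1 ?addr0 // => t /negPf->.
have p0 (v : {ffun 'I_N -> R}) i : 0 <= (v i == 0)%:R + x by rewrite addr_ge0 // ltW.
have -> : #|light_vectors R N d|%:R * x ^+ d = \sum_(v in light_vectors R N d) x ^+ d.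
  by rewrite sumr_const mulr_natl.
rewrite [leLHS]big_mkcond; apply: ler_sum => v _.
case: ifP => [|_]; last exact: prodr_ge0.
rewrite inE => /andP[_ wv]; rewrite (bigID (fun i => v i != 0)) /=.
apply: (@le_trans _ _ (x ^+ weight v * 1)).
  by rewrite mulr1 ler_wiXn2l // ltW.
apply: ler_pM => //; first by rewrite exprn_ge0 // ltW.
  rewrite /weight cardsE -prodr_const; apply: ler_prod => i vi.
  by rewrite (ltW x0) lerDr ler0n.
have {1}-> : 1 = \prod_(i | ~~ (v i != 0)) 1 :> K by rewrite big1.
apply: ler_prod => i; rewrite negbK => /eqP->.
by rewrite eqxx ler01 lerDl ltW.
Qed.

(** * A faithful character of [Z/n] *)

Lemma prim_root_exists (C : numClosedFieldType) n :
  (0 < n)%N -> exists z : C, n.-primitive_root z.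
Proof.
move=> n0; pose P : {poly C} := 'X^n - 1; have [r Dp] := closed_field_poly_normal P.
rewrite (monicP _) ?monicXnsubC // scale1r in Dp.
have rn1 : all n.-unity_root r by apply/allP=> z; rewrite -root_prod_XsubC -Dp.
have sz_r : (n < (size r).+1)%N by rewrite -(size_prod_XsubC r id) -Dp size_XnsubC.
have [|z] := hasP (cyclic.has_prim_root n0 rn1 _ sz_r); last by exists z.
by rewrite -separable_prod_XsubC -Dp separable_Xn_sub_1 // pnatr_eq0 -lt0n.
Qed.

Section ZpCharacter.

Variables (C : numClosedFieldType) (n : nat) (z : C).
Hypothesis n1 : (1 < n)%N.
Hypothesis zn : n.-primitive_root z.

Definition Zp_char (x : 'Z_n) : C := z ^+ (x : nat).

Lemma Zp_char0 : Zp_char 0 = 1.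
Proof. by rewrite /Zp_char expr0. Qed.

Lemma Zp_charD : {morph Zp_char : x y / x + y >-> x * y}.
Proof.
move=> x y; rewrite /Zp_char -exprD -(prim_expr_mod zn (x + y)).
by congr (z ^+ _); congr (_ %% _)%N; apply: Zp_cast.
Qed.

Lemma norm_Zp_char x : `|Zp_char x| = 1.
Proof.
rewrite normrX; suff -> : `|z| = 1 by rewrite expr1n.
apply/eqP; rewrite -(pexpr_eq1 (n := n)) ?(ltnW n1) //.
by rewrite -normrX (prim_expr_order zn) normr1.
Qed.

Lemma Zp_char_faithful x : Zp_char x = 1 -> x = 0.
Proof.
move/eqP; rewrite /Zp_char -(prim_order_dvd zn) => /dvdn_leq.
have xn : (x < n)%N by have := ltn_ord x; move/leq_trans; apply; rewrite Zp_cast.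
case: (posnP x) => [x0 _|x0 /(_ isT)]; first exact: val_inj.
by rewrite leqNgt xn.
Qed.

End ZpCharacter.

(** * Reduction modulo [p] *)

Section Reduction.

Variables p a : nat.
Hypothesis p_prime : prime p.
Hypothesis a_gt0 : (0 < a)%N.

Let q_gt1 : (1 < p ^ a)%N.
Proof. by rewrite -(exp1n a) ltn_exp2r // prime_gt1. Qed.

Definition mod_p (y : 'Z_(p ^ a)) : 'Z_p := (nat_of_ord y)%:R.

Lemma mod_pD : {morph mod_p : x y / x + y}.
Proof.
move=> x y; rewrite /mod_p -natrD -[RHS]Zp_nat_mod ?prime_gt1 //.
rewrite -[LHS]Zp_nat_mod ?prime_gt1 //; congr (_%:R).
have -> : nat_of_ord (x + y) = ((x + y) %% p ^ a)%N.
  by congr (_ %% _)%N; apply: Zp_cast.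
by rewrite modn_dvdm // dvdn_exp.
Qed.

Lemma mod_p_nat (f : 'Z_p) : mod_p (nat_of_ord f)%:R = f.
Proof.
apply: ord_inj; rewrite /mod_p val_Zp_nat ?prime_gt1 // val_Zp_nat //.
rewrite modn_dvdm ?dvdn_exp // modn_small //.
by have := ltn_ord f; move/leq_trans; apply; rewrite Zp_cast // prime_gt1.
Qed.

(** If [p] did not divide [y - x], then [p ^ a], which divides [t * (y - x)], would divide [t]. *)
Lemma mul_mod_p (t x y : 'Z_(p ^ a)) : t != 0 -> t * x = t * y -> mod_p x = mod_p y.
Proof.
move=> t0; wlog xy : x y / (x <= y)%N.
  by move=> W; case/orP: (leq_total x y) => [/W//|/W yx /esym/yx].
have valM (u v : 'Z_(p ^ a)) : nat_of_ord (u * v) = ((u * v) %% p ^ a)%N.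
  by congr (_ %% _)%N; apply: Zp_cast.
move/(congr1 (@nat_of_ord _)) => /esym /eqP; rewrite !valM eqn_mod_dvd ?leq_mul2l ?xy ?orbT //.
rewrite -mulnBr => dv; apply: ord_inj; rewrite /mod_p !val_Zp_nat ?prime_gt1 //.
apply/esym/eqP; rewrite eqn_mod_dvd //; apply: contraLR t0 => npd.
rewrite negbK; apply/eqP/ord_inj.
rewrite Gauss_dvdl ?coprimeXl ?prime_coprime // in dv.
have tn : (t < p ^ a)%N by have := ltn_ord t; move/leq_trans; apply; rewrite Zp_cast.
by case: (posnP t) => [-> //|/dvdn_leq /(_ dv)]; rewrite leqNgt tn.
Qed.

(** Translations permute the residue classes, so their [p] masses are equal, and they add up to
    1. *)
Lemma unif_class_mod_p (K : numFieldType) (f : 'Z_p) :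
  \sum_(x | mod_p x == f) #|'Z_(p ^ a)|%:R^-1 = p%:R^-1 :> K.
Proof.
pose m (f : 'Z_p) : K := \sum_(x | mod_p x == f) #|'Z_(p ^ a)|%:R^-1.
have m0 g : m g = m 0.
  rewrite /m (reindex_inj (addIr (nat_of_ord g)%:R)) /=; apply: eq_bigl => x.
  by rewrite mod_pD mod_p_nat -subr_eq0 addrK.
have p0 : p%:R != 0 :> K by rewrite pnatr_eq0 -lt0n prime_gt0.
have : \sum_g m g = 1.
  transitivity (\sum_(x : 'Z_(p ^ a)) #|'Z_(p ^ a)|%:R^-1 : K).
    by rewrite [RHS](partition_big mod_p xpredT).
  by rewrite sumr_const -[LHS]mulr_natl mulfV // pnatr_eq0 -lt0n; apply/card_gt0P; exists 0.
under eq_bigr do rewrite m0.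
have cp : #|'Z_p| = p by rewrite card_ord Zp_cast // prime_gt1.
rewrite sumr_const cp -[m 0 *+ p]mulr_natl => e.
by rewrite -/(m f) m0; apply: (mulfI p0); rewrite e mulfV.
Qed.

End Reduction.

(** * The gap for nontrivial Fourier coefficients *)

Lemma fhat_gap (K : realType) (R : finComNzRingType) (F : finType) (pi : R -> F)
    (chi : R -> K[i]) (xi : R -> K) :
  chi 0 = 1 -> {morph chi : x y / x + y >-> x * y} -> (forall x, `|chi x| = 1) ->
  (forall x, chi x = 1 -> x = 0) ->
  (forall t x y, t != 0 -> t * x = t * y -> pi x = pi y) ->
  (forall x, 0 <= xi x) -> \sum_x xi x = 1 ->
  \sum_f (\sum_(x | pi x == f) xi x) ^+ 2 < 1 ->
  exists2 rho : K, 0 <= rho < 1 &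
    forall t, t != 0 -> `|fhat chi (fun x => (xi x)%:C%C) t| <= rho%:C%C.
Proof.
move=> chi0 chiD norm_chi chi_faithful mul_pi xi0 xi1 s1.
pose e x : K[i] := (xi x)%:C%C.
have e0 x : 0 <= e x by rewrite ler0c.
have e1 : \sum_x e x = 1 by rewrite -rmorph_sum xi1 rmorph1.
(* Equality in the triangle inequality forces [chi (t * x)], hence [pi x], to be
   constant on the support of [xi]. *)
have lt1 t : t != 0 -> `|fhat chi e t| < 1.
  move=> t0.
  have sn : \sum_x `|e x * chi (t * x)| = 1.
    by rewrite -e1; apply: eq_bigr => x _; rewrite normrM norm_chi mulr1 ger0_norm.
  rewrite lt_neqAle -[X in _ && (_ <= X)]sn ler_norm_sum andbT.
  apply/eqP => eq1; move: s1; apply/negP; rewrite -leNgt.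
  have [//|u _ uP] := @normC_sum_eq _ _ xpredT (fun x => e x * chi (t * x)).
    by rewrite sn -eq1.
  have {}uP x : xi x != 0 -> chi (t * x) = u.
    move=> xn; have := uP x isT; rewrite normrM norm_chi mulr1 ger0_norm //.
    by apply: mulfI; rewrite fmorph_eq0.
  have [x0 x0n|none] := pickP (fun x => xi x != 0); last first.
    by move: xi1; rewrite big1 => [/esym/eqP|x _]; rewrite ?oner_eq0 //; apply/eqP/negbFE/none.
  have supp x : xi x != 0 -> pi x = pi x0.
    move=> xn; apply: (mul_pi t) => //; apply/eqP; rewrite -subr_eq0; apply/eqP.
    apply: chi_faithful; rewrite chiD (charN chi0 chiD norm_chi) (uP x) // (uP x0) //.
    by rewrite -normCK -(uP x0) // norm_chi expr1n.
  rewrite (bigD1 (pi x0)) //=.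
  have -> : \sum_(x | pi x == pi x0) xi x = 1.
    rewrite big_mkcond -[RHS]xi1; apply: eq_bigr => x _; case: eqP => // nx.
    by apply/esym/eqP; apply: contra_notT nx; exact: supp.
  by rewrite expr1n lerDl sumr_ge0 // => f _; rewrite sqr_ge0.
(* Norms live in [K[i]], which is only partially ordered; real parts bring them to [K], where the
   maximum over finitely many [t] stays below 1. *)
pose g t : K := complex.Re `|fhat chi e t|.
have gE t : `|fhat chi e t| = (g t)%:C%C by rewrite /g normc_def.
exists (\big[Num.max/0]_(t | t != 0) g t).
  apply/andP; split; first by rewrite bigmax_ge_id.
  by apply: bigmax_lt => // t t0; rewrite -ltcR -gE rmorph1 lt1.
by move=> t t0; rewrite -/e gE lecR; apply: le_bigmax_cond.
Qed.

(** * Total variation and the choice of constants *)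

(** The term [rho ^+ n] is at most each of the first [n] terms of the geometric series. *)
Lemma mulrn_exp_le (K : realFieldType) (rho : K) n :
  0 <= rho < 1 -> n%:R * rho ^+ n <= (1 - rho)^-1.
Proof.
move=> /andP[r0 r1]; have d0 : 0 < 1 - rho by rewrite subr_gt0.
rewrite -[leRHS]mul1r ler_pdivlMr //.
apply: (@le_trans _ _ ((\sum_(i < n) rho ^+ i) * (1 - rho))).
  apply: ler_wpM2r; first exact: ltW.
  rewrite mulr_natl -[n in _ *+ n]card_ord -sumr_const; apply: ler_sum => i _.
  by rewrite ler_wiXn2l ?(ltW r1) // ltnW.
by rewrite mulrC -opprB mulNr -subrX1 opprB lerBlDr lerDl exprn_ge0.
Qed.

Lemma tv_dist_law_le (K : realType) (W : finType) (V : Type) (P Q : W -> K) (Y : W -> V) (b : K) :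
  (forall E : V -> bool, `|\sum_w (P w - Q w) * (E (Y w))%:R| <= b) ->
  tv_dist (law P Y) (law Q Y) <= b.
Proof.
move=> PQ; apply: ge_sup; first by exists `|law P Y set0 - law Q Y set0|, set0.
move=> _ [E _ <-]; apply: le_trans (PQ (fun v => v \in E)).
rewrite le_eqVlt; apply/orP; left; apply/eqP; congr `|_|.
rewrite /law !(big_mkcond (fun w => Y w \in E)) -sumrB; apply: eq_bigr => w _.
by case: (Y w \in E); rewrite ?mulr1 ?mulr0 ?subrr.
Qed.

(** The cutoff [d] is taken proportional to [N]: with a small ratio there are few light vectors,
    while [rho ^+ d.+1] still decays fast enough for [(1 + q * rho ^+ d.+1) ^+ N.-1] to stay
    bounded. *)
Lemma one_step_constant (K : realType) (R : finComNzRingType) (s rho eps : K) :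
  0 < s -> 0 <= rho < 1 -> 0 < eps ->
  exists C : K, forall N, (0 < N)%N -> exists d,
  N%:R * (2 * #|light_vectors R N d|%:R * s ^+ N.-1 +
    (2 ^+ #|R| * #|R|%:R * (1 + #|R|%:R * rho ^+ d.+1) ^+ N.-1 + 1) / 2 * s ^+ N)
  <= C * expR (eps * N%:R) * s ^+ N.
Proof.
move=> s0 rho01 eps0; have /andP[r0 r1] := rho01.
set q : K := #|R|%:R.
have q0 : 0 < q by rewrite ltr0n; apply/card_gt0P; exists 0.
(* The exponent is split in three: one share pays for the factor [N], two for the number of light
   vectors. *)
pose e3 := eps / 3; have e30 : 0 < e3 by rewrite divr_gt0.
pose x := Num.min 1 (e3 / q).
have x0 : 0 < x by rewrite lt_min ltr01 divr_gt0.
have x1 : x <= 1 by rewrite ge_min lexx.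
have qx : 1 + q * x <= expR e3.
  apply: le_trans (expR_ge1Dx _); rewrite lerD2l mulrC -ler_pdivlMr //.
  by rewrite ge_min lexx orbT.
have xe0 : 0 <= x^-1 / e3 by rewrite divr_ge0 ?invr_ge0 // ltW.
(* With this [m] and [d = N %/ m], the factor [x^-1 ^+ d] costs at most one share [T]. *)
have [m mP] : exists m, x^-1 / e3 < m%:R.
  exists (Num.bound (x^-1 / e3)).
  exact: archi_boundP.
have m0 : (0 < m)%N.
  by rewrite -(ltr0n K); apply: le_lt_trans mP.
have xm : x^-1 <= expR (m%:R * e3).
  apply: le_trans (expR_ge1Dx _); apply: ltW; apply: lt_le_trans (_ : m%:R * e3 <= _).
    by rewrite -ltr_pdivrMr.
  by rewrite lerDr.
pose B := expR (q * m%:R / (1 - rho)).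
pose c1 := 2 / s; pose c2 := (2 ^+ #|R| * q * B + 1) / 2.
exists (e3^-1 * (c1 + c2)) => N N0; exists (N %/ m)%N; set d := (N %/ m)%N.
set L : K := #|_|%:R.
pose T := expR (e3 * N%:R).
have T1 : 1 <= T by rewrite -expR0 ler_expR mulr_ge0 // ltW.
have T3 : expR (eps * N%:R) = T * T * T.
  by rewrite /T -!expRD /e3; congr expR; field.
have NT : N%:R <= e3^-1 * T.
  rewrite mulrC ler_pdivlMr //; apply: le_trans (expR_ge1Dx _).
  by rewrite mulrC lerDr.
have LT : L <= T * T.
  have Lx := @card_light_vectors K R N d x; rewrite x0 x1 in Lx.
  have {}Lx := Lx isT.
  have xd : x ^+ d != 0 by rewrite expf_neq0 // gt_eqF.
  have -> : L = L * x ^+ d * x^-1 ^+ d by rewrite -mulrA exprVn mulfV ?mulr1.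
  apply: ler_pM.
  - by rewrite mulr_ge0 // exprn_ge0 // ltW.
  - by rewrite exprn_ge0 // invr_ge0 ltW.
  - apply: (le_trans Lx); rewrite /T expRM_natr.
    by apply: lerXn2r; rewrite ?nnegrE ?expR_ge0 // addr_ge0 // mulr_ge0 // ltW.
  - apply: (@le_trans _ _ (expR (m%:R * e3) ^+ d)).
      by apply: lerXn2r; rewrite ?nnegrE ?expR_ge0 // invr_ge0 ltW.
    rewrite -expRM_natl ler_expR mulrA -natrM [leRHS]mulrC.
    by apply: ler_wpM2r; rewrite ?ler_nat ?leq_trunc_div // ltW.
have BT : (1 + q * rho ^+ d.+1) ^+ N.-1 <= B.
  apply: (@le_trans _ _ (expR (q * rho ^+ d.+1) ^+ N.-1)).
    apply: lerXn2r; rewrite ?nnegrE ?expR_ge0 ?expR_ge1Dx //.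
    by rewrite addr_ge0 // mulr_ge0 ?exprn_ge0 // ltW.
  rewrite -expRM_natl ler_expR /B -mulrA mulrCA; apply: ler_wpM2l; first exact: ltW.
  (* As [d] is rounded down, it is [d.+1] that satisfies [N.-1 <= d.+1 * m]. *)
  apply: (@le_trans _ _ (m%:R * (d.+1%:R * rho ^+ d.+1))).
    rewrite mulrA -natrM; apply: ler_wpM2r; first by rewrite exprn_ge0.
    rewrite ler_nat mulnC; apply: leq_trans (leq_pred _) _.
    by apply: ltnW; rewrite {1}(divn_eq N m) -/d mulSn addnC ltn_add2r ltn_mod.
  by apply: ler_wpM2l => //; apply: mulrn_exp_le.
have sN : s ^+ N.-1 = s ^+ N / s.
  by rewrite -{2}(prednK N0) exprSr mulfK // gt_eqF.
have T0 : 0 <= T by rewrite expR_ge0.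
have T2 : 1 <= T * T by rewrite -[leLHS]mulr1 ler_pM.
have inner : 2 * L * s ^+ N.-1 +
    (2 ^+ #|R| * q * (1 + q * rho ^+ d.+1) ^+ N.-1 + 1) / 2 * s ^+ N <=
    T * T * (c1 + c2) * s ^+ N.
  rewrite sN [2 * L * _]mulrA [2 * L * _ / _]mulrAC -mulrDl.
  apply: ler_wpM2r; first by rewrite exprn_ge0 // ltW.
  rewrite mulrDr; apply: lerD.
    by rewrite mulrAC mulrC; apply: ler_wpM2r => //; rewrite divr_ge0 // ltW.
  apply: (@le_trans _ _ c2).
    rewrite /c2 ler_pM2r ?invr_gt0 // lerD2r; apply: ler_wpM2l => //.
    by rewrite mulr_ge0 ?exprn_ge0 // ltW.
  rewrite -[leLHS]mul1r; apply: ler_wpM2r => //.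
  by rewrite divr_ge0 // addr_ge0 // !mulr_ge0 ?exprn_ge0 ?expR_ge0 // ltW.
apply: (@le_trans _ _ (e3^-1 * T * (T * T * (c1 + c2) * s ^+ N))).
  apply: ler_pM => //.
  have B1 : 0 <= 1 + q * rho ^+ d.+1 by rewrite addr_ge0 // mulr_ge0 ?exprn_ge0 ?(ltW q0).
  apply: addr_ge0; first by rewrite !mulr_ge0 ?exprn_ge0 ?(ltW s0).
  apply: mulr_ge0; last by rewrite exprn_ge0 ?(ltW s0).
  by apply: divr_ge0 => //; rewrite addr_ge0 // !mulr_ge0 ?exprn_ge0 ?(ltW q0).
rewrite T3 le_eqVlt; apply/orP; left; apply/eqP; ring.
Qed.

(** * Assembly of the bound *)

Theorem mainTheorem6 (K : realType) (p a : nat) (xi : 'Z_(p ^ a) -> K) :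
  prime p -> (1 <= a)%N -> is_pmf xi -> no_affine_subring xi ->
  forall eps : K, 0 < eps ->
  exists C : K,
  forall N k : nat, (1 <= N)%N -> (1 <= k)%N ->
  forall (T : Type) (f : 'M['Z_(p ^ a)]_N -> T), SL_right_invariant f ->
    tv_dist
      (law (iid_pmf (iid_mx_pmf xi (N := N)) (k := k))
           (product_chain f (k := k)))
      (law (iid_pmf (@unif_mx_pmf K _ N) (k := k))
           (product_chain f (k := k)))
    <= k%:R * C * expR (eps * N%:R) * l2_norm_mod xi ^+ N.
Proof.
move=> p_prime a0 [xi0 xi1] _ eps eps0.
set s := l2_norm_mod xi.
pose m (f : 'Z_p) := \sum_(y | mod_p y == f) xi y.
have s2 : s ^+ 2 = \sum_f m f ^+ 2.
  by rewrite sqr_sqrtr // sumr_ge0 // => f _; rewrite sqr_ge0.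
have m0 f : 0 <= m f by apply: sumr_ge0.
have m1 : \sum_f m f = 1 by rewrite -xi1 [RHS](partition_big (@mod_p p a) xpredT).
have m_le1 f : m f <= 1 by rewrite -m1 (bigD1 f) //= lerDl sumr_ge0.
have s_ge0 : 0 <= s by rewrite sqrtr_ge0.
have s2_le1 : s ^+ 2 <= 1.
  by rewrite s2 -[leRHS]m1; apply: ler_sum => f _; rewrite expr2 ler_piMr.
have s_le1 : s <= 1 by rewrite -(expr_le1 (n := 2)).
have p0 : 0 < p%:R :> K by rewrite ltr0n prime_gt0.
(* The difference is the squared distance of the residue masses from uniform. This yields [0 < s]
   and also [p%:R^-1 <= s], the class bound required of uniform entries. *)
have ps2 : p%:R^-1 <= s ^+ 2.
  rewrite -subr_ge0.
  have -> : s ^+ 2 - p%:R^-1 = \sum_f (m f - p%:R^-1) ^+ 2.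
    under [RHS]eq_bigr do rewrite sqrrB.
    rewrite big_split sumrB -s2 sumrMnl -mulr_suml m1 /= sumr_const.
    have -> : #|'Z_p| = p by rewrite card_ord Zp_cast // prime_gt1.
    by rewrite -mulr_natl; field; rewrite gt_eqF.
  by apply: sumr_ge0 => f _; rewrite sqr_ge0.
have s0 : 0 < s.
  rewrite lt_neqAle s_ge0 andbT eq_sym; apply: contraTneq ps2 => ->.
  by rewrite expr0n /= -ltNge invr_gt0.
have ps : p%:R^-1 <= s by apply: (le_trans ps2); rewrite expr2 ler_piMr.
have q_gt1 : (1 < p ^ a)%N by rewrite -(exp1n a) ltn_exp2r // prime_gt1.
have mu0 N : forall A : 'M_N, 0 <= iid_mx_pmf xi A.
  by move=> A; apply: prodr_ge0 => i _; apply: prodr_ge0.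
have mu1 N : \sum_(A : 'M_N) iid_mx_pmf xi A = 1.
  rewrite (reindex _ (onW_bij _ (mx_of_cols_bij _ N))) /=.
  transitivity (\sum_(w : {ffun 'I_N -> {ffun 'I_N -> 'Z_(p ^ a)}}) \prod_j \prod_i xi (w j i)).
    apply: eq_bigr => w _; rewrite /iid_mx_pmf exchange_big; apply: eq_bigr => j _.
    by apply: eq_bigr => i _; rewrite mxE.
  apply: (sum_prod_ffun1
    (c := fun (j : 'I_N) (y : {ffun 'I_N -> 'Z_(p ^ a)}) => \prod_i xi (y i))) => j.
  exact: (sum_prod_ffun1 (c := fun=> xi)).
(* When [s = 1] nothing decays, and the constant 2 suffices because the two laws have total mass
   2. *)
have [s_lt1|s_ge1] := ltP s 1; last first.
  have s1 : s = 1 by apply/eqP; rewrite eq_le s_le1.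
  exists 2 => N k _ k1 T f _; rewrite s1 expr1n mulr1.
  apply: tv_dist_law_le => E.
  apply: (@le_trans _ _ 2); last first.
    rewrite mulrC -[leLHS]mul1r; apply: ler_pM => //.
      by rewrite -[leLHS]expR0 ler_expR mulr_ge0 // ltW.
    by rewrite ler_peMl // ler1n.
  apply: (le_trans (ler_norm_sum _ _ _)).
  have -> : 2 = \sum_(w : {ffun 'I_k -> 'M['Z_(p ^ a)]_N})
      (iid_pmf (iid_mx_pmf xi (N := N)) w + iid_pmf (@unif_mx_pmf K _ N) w).
    rewrite big_split /= /iid_pmf (sum_prod_ffun1 (c := fun=> iid_mx_pmf xi (N := N))) //.
    by rewrite (sum_prod_ffun1 (c := fun=> @unif_mx_pmf K _ N)) // => _; exact: sum_unif_mx.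
  apply: ler_sum => w _; rewrite normrM -[leRHS]mulr1; apply: ler_pM => //.
    apply: (le_trans (ler_normB _ _)); rewrite !ger0_norm //; apply: prodr_ge0 => i _ //.
    by rewrite invr_ge0.
  by case: (E _); rewrite ?normr1 ?normr0.
have [z zq] := @prim_root_exists K[i] (p ^ a) (ltnW q_gt1).
have c0 := Zp_char0 (p ^ a) z.
have cD := Zp_charD q_gt1 zq.
have cN := norm_Zp_char q_gt1 zq.
have cF := Zp_char_faithful q_gt1 zq.
have pM := mul_mod_p p_prime a0.
have [|rho rho01 gap] := fhat_gap c0 cD cN cF pM xi0 xi1.
  by rewrite -s2 expr_lt1.
have [C CP] := @one_step_constant K 'Z_(p ^ a) s rho eps s0 rho01 eps0.
exists C => N k N1 k1 T f finv.
have [d dP] := CP N N1.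
(* For each event [E], [chain_step] costs the factor [k] and leaves the comparison of a single
   matrix with a uniform one. *)
apply: tv_dist_law_le => E; rewrite -!mulrA; apply: (@chain_step _ _ _ _ f k) => // h h1 hinv.
rewrite mulrA; apply: le_trans dP; case/andP: rho01 => r0 r1.
apply: (matrix_step c0 cD cN cF pM) => //; first by rewrite r0 ltW.
by move=> g; rewrite unif_class_mod_p.
Qed.
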